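(* Let $p$ be a prime, $K$ a finite extension of $\mathbb{Q}_p$, and $A\subset K((\frac1T))$ a $K$-subalgebra with $A\cap K[[\frac1T]]=K$ and $\dim_KK((\frac1T))/(A+K[[\frac1T]])<\infty$, which is strictly integral. Let $b(T)\in O(A)\oplus\frac1TO_K[[\frac1T]]$ and $n\in\mathbb{Z}_{>0}$. If $c,\pi\in\mathcal{M}_K$ satisfy $|c|<|p^{n-1}|$ and $|\pi|\le|p|^{1/(p^n-p^{n-1})}$, then $$\Big[\exp\Big(c\sum_{k=0}^\infty\frac{\pi^{p^k}}{p^k}b(T)\Big)\Big]=1\quad\text{in }\Gamma_A.$$
   Context: $|\cdot|$ is the absolute value on $K$ with $|p|=1/p$, $O_K=\{|a|\le1\}$, $\mathcal{M}_K=\{|a|<1\}$. $K((\frac1T))$ is the field of series $\sum_{i\le n}v_iT^i$; the degree is the largest exponent with nonzero coefficient. Write $\{\deg v : 0\ne v\in A\}=\{s_1<s_2<\cdots\}$. The standard basis of $A$ is the unique basis $v_i=\sum_jv_{ij}T^j$ with $v_i$ monic of degree $s_i$ and $v_{i,s_j}=0$ for $i>j\ge1$; $A$ is strictly integral if all $v_{ij}\in O_K$. $O(A)$ is the set of elements of $A$ with all coefficients in $O_K$. $H:=\{\sum_{i\in\mathbb{Z}}a_iT^i : a_i\in K,\ \sup|a_i|<\infty,\ \lim_{i\to+\infty}|a_i|=0\}$, a field complete for $\|\sum a_iT^i\|=\sup|a_i|$. $A^{\mathrm{an}}$ is the closure of $A$ in $H$. For $0\le\rho<1$, $\Gamma_\rho:=\{h=\sum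 h_iT^i\in H^* : \|h\|=|h_0|=1,\ |h_i|\le\rho^i\ \forall i>0\}$, $\Gamma:=\bigcup_{0\le\rho<1}\Gamma_\rho$, $\Gamma_A:=\Gamma/\big(((A^{\mathrm{an}})^*\cap\Gamma)\Gamma_0\big)$; $[h]$ is the class of $h\in\Gamma$. The exponential is taken in $H$ (part of the assertion is that it converges to an element of $\Gamma$). *)

(* Defs.v *)
From HB Require Import structures.
From mathcomp Require Export all_boot all_order all_algebra all_field.
From mathcomp Require Export all_classical all_reals all_analysis.

Set Implicit Arguments.
Unset Strict Implicit.
Unset Printing Implicit Defensive.

Export Order.TTheory GRing.Theory Num.Theory.
Export numFieldNormedType.Exports.

#[global] Open Scope classical_set_scope.
#[global] Open Scope ring_scope.

Section AbsoluteValues.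
Context {R : realType}.

Record nonarch_abs (K : fieldType) (abs : K -> R) : Prop := NonarchAbs {
  nabs_ge0 : forall x, 0 <= abs x;
  nabs_eq0 : forall x, abs x = 0 <-> x = 0;
  nabsM : forall x y, abs (x * y) = abs x * abs y;
  nabsD : forall x y, abs (x + y) <= Num.max (abs x) (abs y) }.

Definition abs_cvg (K : fieldType) (abs : K -> R) (u : nat -> K) (l : K) : Prop :=
  (fun n => abs (u n - l)) @ \oo --> (0 : R).

Definition abs_cauchy (K : fieldType) (abs : K -> R) (u : nat -> K) : Prop :=
  forall e : R, 0 < e ->
    exists N : nat, forall m n : nat, (N <= m)%N -> (N <= n)%N ->
      abs (u m - u n) < e.

Definition padic_abs (p : nat) (x : rat) : R :=
  if x == 0 then 0
  else p%:R ^ ((logn p `|denq x|%N)%:Z - (logn p `|numq x|%N)%:Z).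

(* MathComp has no field of p-adic numbers. (Qp, abs) is determined by the
   following property up to a unique isometric isomorphism: it is the
   completion of rat for the p-adic absolute value. *)
Record is_padic_field (p : nat) (Qp : fieldType) (abs : Qp -> R) : Prop :=
  IsPadicField {
  padic_nonarch : nonarch_abs abs;
  padic_extends : forall x : rat, abs (ratr x) = padic_abs p x;
  padic_dense : forall (y : Qp) (e : R), 0 < e ->
    exists x : rat, abs (y - ratr x) < e;
  padic_complete : forall u : nat -> Qp, abs_cauchy abs u ->
    exists l : Qp, abs_cvg abs u l }.

(* The absolute value of a finite extension L of Qp that restricts to that of
   Qp; in particular it takes the value 1/p at p. *)
Definition extends_abs (Qp : fieldType) (absQp : Qp -> R)
    (L : fieldExtType Qp) (abs : L -> R) : Prop :=
  nonarch_abs abs /\ forall x : Qp, abs (x%:A) = absQp x.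

End AbsoluteValues.

(* Formal two-sided sums \sum_(i in Z) f i T^i; both K((1/T)) and H are sets of
   such sums. Only the coefficientwise K-module structure is used; the product of
   series is [smul] below, and not [*], which would denote the pointwise product
   of functions. *)
Definition zseries (K : fieldType) : Type := int -> K.

HB.instance Definition _ (K : fieldType) :=
  GRing.Lmodule.copy (zseries K) (int -> K^o).

Section Series.
Context {K : fieldType}.
Implicit Types (f : zseries K) (A : set (zseries K)).

Definition sconst (a : K) : zseries K := fun i => if i == 0 then a else 0.

(* K((1/T)) *)
Definition laurent : set (zseries K) :=
  [set f | exists n : int, forall i : int, n < i -> f i = 0].

(* K[[1/T]] *)
Definition powser : set (zseries K) :=
  [set f | forall i : int, 0 < i -> f i = 0].

Definition has_deg f (d : int) : Prop :=
  f d != 0 /\ forall i : int, d < i -> f i = 0.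

Definition degrees A : set int := [set d | exists2 f, A f & has_deg f d].

Definition is_basis A (v : nat -> zseries K) : Prop :=
  [/\ forall i, A (v i),
      forall f, A f ->
        exists (n : nat) (a : 'I_n -> K), f = \sum_(i < n) a i *: v i &
      forall (n : nat) (a : 'I_n -> K),
        \sum_(i < n) a i *: v i = 0 -> forall i, a i = 0].

(* The degrees and the basis are numbered from 0. *)
Definition standard_basis A (s : nat -> int) (v : nat -> zseries K) : Prop :=
  [/\ forall i j : nat, (i < j)%N -> s i < s j,
      range s = degrees A,
      is_basis A v,
      forall i, has_deg (v i) (s i) /\ v i (s i) = 1 &
      forall i j : nat, (j < i)%N -> v i (s j) = 0].

Definition finite_codim A : Prop :=
  exists (m : nat) (w : 'I_m -> zseries K),
    (forall i, laurent (w i)) /\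
    forall f, laurent f ->
      exists (a g : zseries K) (x : 'I_m -> K),
        [/\ A a, powser g & f = a + g + \sum_(i < m) x i *: w i].

End Series.

Section AnalyticSeries.
Context {R : realType} {K : fieldType}.
Variable abs : K -> R.
Implicit Types (f g h : zseries K) (A B : set (zseries K)).

(* Sum of a doubly infinite family, with junk value 0 if it diverges. *)
Definition zsum (a : int -> K) : K :=
  xget 0 [set l | abs_cvg abs
    (fun n : nat => \sum_(i < n) (a i%:Z + a (- i.+1%:Z))) l].

(* Product of formal sums. On K((1/T)) the families summed here have finite
   support, so this is the algebraic product; on H both tails of the families
   tend to 0, so this is the product of H. *)
Definition smul f g : zseries K := fun k => zsum (fun i => f i * g (k - i)).

Definition sexp f (n : nat) : zseries K := iter n (smul f) (sconst 1).

Definition is_subalgebra A : Prop :=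
  [/\ A `<=` laurent,
      A (sconst 1),
      forall f g, A f -> A g -> A (f + g),
      forall (a : K) f, A f -> A (a *: f) &
      forall f g, A f -> A g -> A (smul f g)].

Definition integral_coefs : set (zseries K) :=
  [set f | forall i, abs (f i) <= 1].

Definition strictly_integral A : Prop :=
  exists (s : nat -> int) (v : nat -> zseries K),
    standard_basis A s v /\ forall i, integral_coefs (v i).

(* O(A) (+) (1/T) O_K[[1/T]] *)
Definition OA_plus_tail A : set (zseries K) :=
  [set b | exists a g : zseries K,
    [/\ A a /\ integral_coefs a,
        (forall i : int, 0 <= i -> g i = 0) /\ integral_coefs g &
        b = a + g]].

Definition Hset : set (zseries K) :=
  [set h | (exists M : R, forall i : int, abs (h i) <= M) /\
           (fun n : nat => abs (h n%:Z)) @ \oo --> (0 : R)].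

Definition Hnorm h : R := sup (range (fun i : int => abs (h i))).

Definition Hclosure B : set (zseries K) :=
  [set h | Hset h /\ forall e : R, 0 < e ->
    exists2 f, (B `&` Hset) f & Hnorm (h - f) < e].

Definition units B : set (zseries K) :=
  [set h | B h /\ exists2 g, B g & smul h g = sconst 1].

Definition Gamma_ (rho : R) : set (zseries K) :=
  [set h | [/\ units Hset h, Hnorm h = 1, abs (h 0) = 1 &
    forall i : nat, (0 < i)%N -> abs (h i%:Z) <= rho ^+ i]].

Definition Gamma : set (zseries K) :=
  [set h | exists2 rho : R, 0 <= rho < 1 & Gamma_ rho h].

(* The subgroup ((A^an)^* \cap Gamma) Gamma_0 of Gamma. *)
Definition GammaA_kernel A : set (zseries K) :=
  [set h | exists2 u, (units (Hclosure A) `&` Gamma) u &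
           exists2 g, Gamma_ 0 g & h = smul u g].

(* The class [h] in Gamma_A, as a coset; the unit of Gamma_A is the class of
   [sconst 1]. *)
Definition GammaA_class A h : set (zseries K) :=
  [set smul h u | u in GammaA_kernel A].

(* exp f converges in H to E *)
Definition is_Hexp f E : Prop :=
  Hset E /\
  (fun n : nat => Hnorm (\sum_(k < n) (k`!%:R)^-1 *: sexp f k - E)) @ \oo
    --> (0 : R).

End AnalyticSeries.

(* Main.v *)
(* Write [b = a + g] with [a] in [O(A)] and [g] in [(1/T) O_K[[1/T]]], and put
   [al = |p|^(1/(p-1))]. Among the valuations [p^k v(varpi) - k] of the terms of
   the series [S], the lower bound given by the hypothesis is smallest for
   [k = n-1] and [k = n], so that [|S| <= al / |p|^(n-1)], whence [|c S| < al].
   Legendre's formula gives [|k!| >= al^k], hence [|(c S)^k / k!| <= t^k] with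
   [t = |c S| / al < 1], and the exponential series of [c S b], [c S a] and
   [c S g] converge geometrically in [H]. Thus
   [exp (c S b) = exp (c S a) exp (c S g)]; the first factor is a limit of
   elements of [A], with inverse [exp (- c S a)], and the second has no positive
   powers of [T]. If [a] has degree at most [N], the coefficient of [T^i] in
   [exp (c S a)] only involves the terms with [k >= i / N], so it is bounded by
   [(t^(1/N))^i]; this puts the exponential in [Gamma]. *)
From HB Require Import structures.
Require Import Defs.
From mathcomp Require Import zify ring lra.

Set Implicit Arguments.
Unset Strict Implicit.
Unset Printing Implicit Defensive.

(** * Unordered sums over a nonarchimedean field *)

Section NonarchimedeanField.
Context (R : realType) (K : fieldType) (abs : K -> R).
Hypothesis abs_na : nonarch_abs abs.

Lemma nabs0 : abs 0 = 0. Proof. exact/(nabs_eq0 abs_na). Qed.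

Lemma nabs_gt0 x : x != 0 -> 0 < abs x.
Proof.
move=> x0; rewrite lt_def nabs_ge0 // andbT.
by apply: contra x0 => /eqP /(nabs_eq0 abs_na) ->.
Qed.

Lemma nabs1 : abs 1 = 1.
Proof.
have /mulfI : abs 1 != 0 by rewrite gt_eqF // nabs_gt0 ?oner_eq0.
by apply; rewrite -(nabsM abs_na) !mulr1.
Qed.

Lemma nabsX x k : abs (x ^+ k) = abs x ^+ k.
Proof.
elim: k => [|k IH]; first by rewrite !expr0 nabs1.
by rewrite !exprS (nabsM abs_na) IH.
Qed.

Lemma nabsV x : abs x^-1 = (abs x)^-1.
Proof.
have [->|x0] := eqVneq x 0; first by rewrite invr0 nabs0 invr0.
have ax0 : abs x != 0 by rewrite gt_eqF // nabs_gt0.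
by apply: (mulfI ax0); rewrite -(nabsM abs_na) !mulfV // nabs1.
Qed.

Lemma nabsN x : abs (- x) = abs x.
Proof.
apply/eqP; rewrite -(@eqrXn2 _ 2) ?nabs_ge0 //.
by rewrite -!nabsX sqrrN.
Qed.

Lemma nabs_distC x y : abs (x - y) = abs (y - x).
Proof. by rewrite -nabsN opprB. Qed.

Lemma nabsD_le x y (M : R) : abs x <= M -> abs y <= M -> abs (x + y) <= M.
Proof.
by move=> xM yM; apply: (le_trans (nabsD abs_na x y)); rewrite ge_max xM.
Qed.

Lemma nabsD_lt x y (M : R) : abs x < M -> abs y < M -> abs (x + y) < M.
Proof.
by move=> xM yM; apply: (le_lt_trans (nabsD abs_na x y)); rewrite gt_max xM.
Qed.

Lemma nabsB_lt x y (M : R) : abs x < M -> abs y < M -> abs (x - y) < M.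
Proof. by move=> ? ?; apply: nabsD_lt; rewrite ?nabsN. Qed.

Lemma nabs_dist_lt z x y (M : R) :
  abs (x - z) < M -> abs (z - y) < M -> abs (x - y) < M.
Proof.
move=> ? ?; have -> : x - y = (x - z) + (z - y) by ring.
exact: nabsD_lt.
Qed.

Lemma nabs_dist_le z x y (M : R) :
  abs (x - z) <= M -> abs (z - y) <= M -> abs (x - y) <= M.
Proof.
move=> ? ?; have -> : x - y = (x - z) + (z - y) by ring.
exact: nabsD_le.
Qed.

Lemma nabs_sum_le (I : Type) (r : seq I) (P : pred I) (F : I -> K) (M : R) :
  0 <= M -> (forall i, P i -> abs (F i) <= M) ->
  abs (\sum_(i <- r | P i) F i) <= M.
Proof.
move=> M0 FM; apply: (big_ind (fun x => abs x <= M)) => //.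
  by rewrite nabs0.
by move=> x y; exact: nabsD_le.
Qed.

Lemma nabs_sum_lt (I : Type) (r : seq I) (P : pred I) (F : I -> K) (M : R) :
  0 < M -> (forall i, P i -> abs (F i) < M) ->
  abs (\sum_(i <- r | P i) F i) < M.
Proof.
move=> M0 FM; apply: (big_ind (fun x => abs x < M)) => //.
  by rewrite nabs0.
by move=> x y; exact: nabsD_lt.
Qed.

Lemma nabs_eq_of_lt x y : abs (x - y) < abs y -> abs x = abs y.
Proof.
move=> xy; apply/eqP; rewrite eq_le; apply/andP; split.
  by rewrite -(subrK y x); apply: nabsD_le => //; exact: ltW.
rewrite leNgt; apply/negP => xy'.
suff : abs y < abs y by rewrite ltxx.
have {1}-> : y = x - (x - y) by ring.
exact: nabsB_lt.
Qed.

Lemma abs_cvgP (u : nat -> K) l : abs_cvg abs u l <->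
  forall e : R, 0 < e -> exists N : nat, forall n, (N <= n)%N -> abs (u n - l) < e.
Proof.
split=> [/cvgrPdist_lt h e e0|h].
  have [N _ hN] := h _ e0; exists N => n Nn; have := hN n Nn.
  by rewrite sub0r normrN ger0_norm ?nabs_ge0.
apply/cvgrPdist_lt => e e0; have [N hN] := h _ e0; exists N => // n /= Nn.
by rewrite sub0r normrN ger0_norm ?nabs_ge0 // hN.
Qed.

Lemma abs_cvg_unique (u : nat -> K) l l' :
  abs_cvg abs u l -> abs_cvg abs u l' -> l = l'.
Proof.
move=> /abs_cvgP h /abs_cvgP h'; apply/eqP; rewrite -subr_eq0; apply: contraT => ll'.
have [N hN] := h _ (nabs_gt0 ll'); have [N' hN'] := h' _ (nabs_gt0 ll').
suff : abs (l - l') < abs (l - l') by rewrite ltxx.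
apply: (@nabs_dist_lt (u (maxn N N'))); last by rewrite hN' ?leq_maxr.
by rewrite nabs_distC hN ?leq_maxl.
Qed.

Lemma abs_cvg_cauchy (u : nat -> K) l : abs_cvg abs u l -> abs_cauchy abs u.
Proof.
move=> /abs_cvgP h e /h[N hN]; exists N => m n Nm Nn.
by apply: (@nabs_dist_lt l); [|rewrite nabs_distC]; apply: hN.
Qed.

Lemma abs_cvg_le (u : nat -> K) l (M : R) : abs_cvg abs u l ->
  (exists N : nat, forall n, (N <= n)%N -> abs (u n) <= M) -> abs l <= M.
Proof.
move=> /abs_cvgP h [N uM]; rewrite leNgt; apply/negP => Ml.
have M0 : 0 <= M by exact: le_trans (nabs_ge0 abs_na _) (uM N (leqnn _)).
have [N' hN] := h _ (le_lt_trans M0 Ml).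
suff /nabs_eq_of_lt lu : abs (u (maxn N N') - l) < abs l.
  by have := uM (maxn N N') (leq_maxl _ _); rewrite lu leNgt Ml.
by rewrite hN ?leq_maxr.
Qed.

Definition abs_complete := forall u : nat -> K, abs_cauchy abs u ->
  exists l : K, abs_cvg abs u l.

Lemma exists_inv_natS_lt (e : R) : 0 < e -> exists n : nat, n.+1%:R^-1 < e.
Proof.
move=> e0; have [n] := @ltr_add_invr R 0 e e0.
by rewrite add0r => ?; exists n.
Qed.

Definition has_sum (I : eqType) (a : I -> K) (l : K) :=
  forall e : R, 0 < e -> exists s : seq I, forall t : seq I,
    uniq t -> {subset s <= t} -> abs (\sum_(i <- t) a i - l) < e.

Definition null_family (I : eqType) (a : I -> K) :=
  forall e : R, 0 < e -> exists s : seq I, forall i, i \notin s -> abs (a i) < e.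

Lemma big_uniq_subset (I : eqType) (s t : seq I) (a : I -> K) :
  uniq s -> uniq t -> {subset s <= t} ->
  \sum_(i <- t) a i = \sum_(i <- s) a i + \sum_(i <- t | i \notin s) a i.
Proof.
move=> us ut st; rewrite (bigID (mem s)) /=; congr (_ + _).
rewrite -big_filter; apply: perm_big; apply: uniq_perm => //.
  exact: filter_uniq.
move=> i; rewrite mem_filter; apply/andP/idP => [[]//|si]; split => //.
exact: st.
Qed.

Lemma null_has_sum (I : eqType) (a : I -> K) : abs_complete ->
  null_family a -> exists l, has_sum a l.
Proof.
move=> cpl na.
have /choice[s hs] : forall n : nat, exists s : seq I,
    forall i, i \notin s -> abs (a i) < n.+1%:R^-1.
  by move=> n; apply: na; rewrite invr_gt0.
pose S n := undup (flatten [seq s i | i <- iota 0 n.+1]).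
have sS m n : (m <= n)%N -> {subset s m <= S n}.
  move=> mn i mi; rewrite mem_undup; apply/flattenP; exists (s m) => //.
  by apply: map_f; rewrite mem_iota add0n ltnS.
have near_S n t : uniq t -> {subset S n <= t} ->
    abs (\sum_(i <- t) a i - \sum_(i <- S n) a i) < n.+1%:R^-1.
  move=> ut St; rewrite (big_uniq_subset _ (undup_uniq _) ut St) addrC addKr.
  apply: nabs_sum_lt => [|i Si]; first by rewrite invr_gt0.
  by apply: hs; apply: contra Si; exact: sS.
have SS m n : (m <= n)%N -> {subset S m <= S n}.
  move=> mn i; rewrite mem_undup => /flattenP[_ /mapP[k + ->] ik].
  by rewrite mem_iota add0n ltnS => km; apply: (sS k); rewrite ?(leq_trans km).
have [l /abs_cvgP hl] : exists l, abs_cvg abs (fun n => \sum_(i <- S n) a i) l.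
  apply: cpl => e /exists_inv_natS_lt[N Ne]; exists N => m n Nm Nn.
  apply: lt_trans Ne; apply: (@nabs_dist_lt (\sum_(i <- S N) a i)).
    by apply: near_S; [exact: undup_uniq|exact: SS].
  by rewrite nabs_distC; apply: near_S; [exact: undup_uniq|exact: SS].
exists l => e e0.
have [N Ne] := exists_inv_natS_lt e0; have [N' hN'] := hl _ e0.
exists (S (maxn N N')) => t ut St.
apply: (@nabs_dist_lt (\sum_(i <- S (maxn N N')) a i)).
  apply: lt_trans (near_S _ _ ut St) _; apply: le_lt_trans Ne.
  by rewrite lef_pV2 ?posrE // ler_nat ltnS leq_maxl.
by apply: hN'; exact: leq_maxr.
Qed.

Lemma has_sum_le (I : eqType) (a : I -> K) l (M : R) : 0 <= M ->
  (forall i, abs (a i) <= M) -> has_sum a l -> abs l <= M.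
Proof.
move=> M0 aM h; rewrite leNgt; apply/negP => Ml.
have [s hs] := h _ (le_lt_trans M0 Ml).
have /nabs_eq_of_lt lu := hs (undup s) (undup_uniq _) (fun i => etrans (mem_undup s i)).
suff : abs (\sum_(i <- undup s) a i) <= M by rewrite lu leNgt Ml.
exact: nabs_sum_le.
Qed.

Lemma has_sumD (I : eqType) (a b : I -> K) l l' :
  has_sum a l -> has_sum b l' -> has_sum (fun i => a i + b i) (l + l').
Proof.
move=> ha hb e e0; have [s hs] := ha _ e0; have [s' hs'] := hb _ e0.
exists (s ++ s') => t ut st; rewrite big_split /=.
have -> : forall x y : K, x + y - (l + l') = (x - l) + (y - l') by move=> x y; ring.
by apply: nabsD_lt; [apply: hs|apply: hs'] => // i si; apply: st;
  rewrite mem_cat si ?orbT.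
Qed.

Lemma has_sumZ (I : eqType) (a : I -> K) c l :
  has_sum a l -> has_sum (fun i => c * a i) (c * l).
Proof.
move=> ha; have [->|c0] := eqVneq c 0.
  move=> e e0; exists [::] => t _ _; rewrite big1 => [|i _]; last by rewrite mul0r.
  by rewrite mul0r subrr nabs0.
move=> e e0; have ac := nabs_gt0 c0.
have [s hs] := ha _ (divr_gt0 e0 ac); exists s => t ut st.
by rewrite -mulr_sumr -mulrBr (nabsM abs_na) mulrC -ltr_pdivlMr // hs.
Qed.

Lemma has_sum_reindex (I J : eqType) (h : J -> I) (g : I -> J) (a : I -> K) l :
  cancel h g -> cancel g h -> has_sum a l -> has_sum (a \o h) l.
Proof.
move=> hK gK ha e e0; have [s hs] := ha _ e0; exists (map g s) => t ut st.
rewrite -(big_map h predT a); apply: hs.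
  by rewrite map_inj_uniq //; exact: can_inj hK.
by move=> i si; rewrite -(gK i) map_f // st // map_f.
Qed.

Lemma has_sum_fubini (I J : eqType) (a : I * J -> K) (b : I -> K) l l' :
  has_sum a l -> (forall i, has_sum (fun j => a (i, j)) (b i)) ->
  has_sum b l' -> l = l'.
Proof.
move=> ha hab hb; apply/eqP; rewrite -subr_eq0; apply: contraT => ll'.
have e0 := nabs_gt0 ll'; set e := abs _ in e0.
have [s hs] := ha _ e0; have [s' hs'] := hb _ e0.
have /choice[r hr] : forall i, exists r : seq J, forall t : seq J, uniq t ->
    {subset r <= t} -> abs (\sum_(j <- t) a (i, j) - b i) < e.
  by move=> i; exact: hab.
pose t := undup (s' ++ map fst s).
pose u := undup (flatten (map r t) ++ map snd s).
have [ut uu] : uniq t /\ uniq u by rewrite !undup_uniq.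
suff : e < e by rewrite ltxx.
apply: (@nabs_dist_lt (\sum_(i <- t) \sum_(j <- u) a (i, j))).
  rewrite nabs_distC; have := hs [seq (i, j) | i <- t, j <- u]; rewrite big_allpairs.
  apply; first by apply: allpairs_uniq => // -[? ?] [? ?] _ _ [-> ->].
  move=> [i j] sij; apply: allpairs_f; rewrite mem_undup mem_cat; apply/orP; right.
    exact: (map_f fst sij).
  exact: (map_f snd sij).
apply: (@nabs_dist_lt (\sum_(i <- t) b i)); last first.
  by apply: hs' => // i si; rewrite mem_undup mem_cat si.
rewrite -sumrB big_seq; apply: nabs_sum_lt => // i ti; apply: hr => // j rj.
rewrite mem_undup mem_cat; apply/orP; left; apply/flattenP; exists (r i) => //.
exact: map_f.
Qed.

Lemma has_sum0 (I : eqType) (a : I -> K) : (forall i, a i = 0) -> has_sum a 0.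
Proof.
move=> a0 e e0; exists [::] => t _ _.
by rewrite big1 ?subr0 ?nabs0 // => i _; exact: a0.
Qed.

Lemma has_sum1 (I : eqType) (a : I -> K) i :
  (forall j, j != i -> a j = 0) -> has_sum a (a i).
Proof.
move=> a0 e e0; exists [:: i] => t ut st.
rewrite (bigD1_seq i) ?st ?mem_head //= big1 => [|j ji]; last exact: a0.
by rewrite addr0 subrr nabs0.
Qed.

End NonarchimedeanField.

(** * The ring H *)

Section AnalyticRing.
Context (R : realType) (K : fieldType) (abs : K -> R).
Hypothesis abs_na : nonarch_abs abs.
Hypothesis abs_cpl : abs_complete abs.
Implicit Types f g h : zseries K.

Definition zwindow (n : nat) : seq int :=
  [seq i%:Z | i <- iota 0 n] ++ [seq - i.+1%:Z | i <- iota 0 n].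

Lemma mem_zwindow n (x : int) : (x \in zwindow n) = (- n%:Z <= x < n%:Z).
Proof.
rewrite mem_cat; apply/orP/idP.
  by case=> /mapP[i]; rewrite mem_iota => hi ->; lia.
move=> hx; case: x hx => i hx; [left|right]; apply/mapP; exists i => //;
  rewrite ?mem_iota; lia.
Qed.

Lemma zwindow_uniq n : uniq (zwindow n).
Proof.
rewrite cat_uniq !map_inj_uniq ?iota_uniq; try by move=> i j; lia.
rewrite andbT /=; apply/hasPn => _ /mapP[i _ ->].
by apply/mapP => -[j _]; lia.
Qed.

Lemma zsumE (a : int -> K) l : has_sum abs a l -> zsum abs a = l.
Proof.
move=> hl; rewrite /zsum; set u := (X in [set l | abs_cvg _ X l]).
suff ul : abs_cvg abs u l.
  by apply: xget_unique => // y uy; exact: abs_cvg_unique uy ul.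
apply/(abs_cvgP abs_na) => e /hl[s hs].
exists (\max_(x <- s) absz x).+1 => n hn.
have -> : u n = \sum_(x <- zwindow n) a x.
  have iotaE (F : nat -> K) : \sum_(i <- iota 0 n) F i = \sum_(i < n) F i.
    by rewrite -(big_mkord xpredT F) /index_iota subn0.
  by rewrite /u big_split /= big_cat /= !big_map !iotaE.
apply: hs; first exact: zwindow_uniq.
move=> x sx; have xs : (absz x <= \max_(x <- s) absz x)%N by exact: leq_bigmax_seq.
by rewrite mem_zwindow; lia.
Qed.

Lemma HsetP h : Hset abs h <-> (exists M : R, forall i, abs (h i) <= M) /\
  forall e : R, 0 < e ->
    exists N : nat, forall i : int, N%:Z <= i -> abs (h i) < e.
Proof.
split=> -[hM h0]; split => //.
  move=> e e0; move/cvgrPdist_lt: h0 => /(_ _ e0)[N _ hN]; exists N => -[i|//] Ni.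
  by have := hN i Ni; rewrite sub0r normrN ger0_norm ?nabs_ge0.
apply/cvgrPdist_lt => e /h0[N hN]; exists N => // n Nn.
by rewrite sub0r normrN ger0_norm ?nabs_ge0 // hN.
Qed.

Lemma Hset_gt1_bound h : Hset abs h ->
  exists2 M : R, 1 <= M & forall i, abs (h i) <= M.
Proof.
by move=> [[M hM] _]; exists (Num.max 1 M) => [|i]; rewrite le_max ?lexx ?hM ?orbT.
Qed.

Lemma smul_null f g k : Hset abs f -> Hset abs g ->
  null_family abs (fun i => f i * g (k - i)).
Proof.
move=> Hf Hg e e0.
have [M M1 fM] := Hset_gt1_bound Hf; have [M' M'1 gM] := Hset_gt1_bound Hg.
have [/HsetP[_ f0] /HsetP[_ g0]] := (Hf, Hg).
have [N fN] := f0 _ (divr_gt0 e0 (lt_le_trans ltr01 M'1)).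
have [N' gN] := g0 _ (divr_gt0 e0 (lt_le_trans ltr01 M1)).
exists (zwindow (N + N' + absz k)%N) => i; rewrite mem_zwindow => hi.
rewrite (nabsM abs_na); have [Ni|iN] := leP N%:Z i.
  have := fN _ Ni; rewrite ltr_pdivlMr; last lra.
  apply: le_lt_trans; apply: ler_wpM2l => //; exact: (nabs_ge0 abs_na).
have /gN : N'%:Z <= k - i by lia.
rewrite ltr_pdivlMr; last lra.
by rewrite mulrC; apply: le_lt_trans; apply: ler_wpM2r => //; exact: (nabs_ge0 abs_na).
Qed.

Lemma smul_has_sum f g k : Hset abs f -> Hset abs g ->
  has_sum abs (fun i => f i * g (k - i)) (smul abs f g k).
Proof.
move=> Hf Hg; have [l hl] := null_has_sum abs_na abs_cpl (smul_null k Hf Hg).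
by rewrite /smul (zsumE hl).
Qed.

Lemma smul_eq f g k l : has_sum abs (fun i => f i * g (k - i)) l ->
  smul abs f g k = l.
Proof. exact: zsumE. Qed.

Lemma smul_le f g k (M : R) : Hset abs f -> Hset abs g -> 0 <= M ->
  (forall i, abs (f i * g (k - i)) <= M) -> abs (smul abs f g k) <= M.
Proof.
by move=> Hf Hg M0 hM; exact: (has_sum_le abs_na M0 hM (smul_has_sum k Hf Hg)).
Qed.

Lemma Hset_smul f g : Hset abs f -> Hset abs g -> Hset abs (smul abs f g).
Proof.
move=> Hf Hg.
have [M M1 fM] := Hset_gt1_bound Hf; have [M' M'1 gM] := Hset_gt1_bound Hg.
have [/HsetP[_ f0] /HsetP[_ g0]] := (Hf, Hg).
apply/HsetP; split.
  exists (M * M') => k; apply: smul_le => // [|i].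
    by apply: mulr_ge0; lra.
  by rewrite (nabsM abs_na); apply: ler_pM; rewrite ?(nabs_ge0 abs_na).
move=> e e0; have e20 : 0 < e / 2 by lra.
have [N fN] := f0 _ (divr_gt0 e20 (lt_le_trans ltr01 M'1)).
have [N' gN] := g0 _ (divr_gt0 e20 (lt_le_trans ltr01 M1)).
exists (N + N')%N => k hk; apply: (@le_lt_trans _ _ (e / 2)); last lra.
apply: smul_le => // [|i]; first exact: ltW.
rewrite (nabsM abs_na); have [Ni|iN] := leP N%:Z i.
  have := fN _ Ni; rewrite ltr_pdivlMr; last lra.
  move/ltW; apply: le_trans; apply: ler_wpM2l => //; exact: (nabs_ge0 abs_na).
have /gN : N'%:Z <= k - i by lia.
rewrite ltr_pdivlMr; last lra.
move/ltW; rewrite mulrC; apply: le_trans.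
by apply: ler_wpM2r => //; exact: (nabs_ge0 abs_na).
Qed.

Lemma smulC f g : Hset abs f -> Hset abs g -> smul abs f g = smul abs g f.
Proof.
move=> Hf Hg; apply/funext => k; apply: smul_eq.
have kK : cancel (fun i : int => k - i) (fun i => k - i) by move=> i; ring.
have := has_sum_reindex kK kK (smul_has_sum k Hg Hf).
congr has_sum; apply/funext => i /=; rewrite mulrC; congr (f _ * _); ring.
Qed.

Lemma smulA f g h : Hset abs f -> Hset abs g -> Hset abs h ->
  smul abs f (smul abs g h) = smul abs (smul abs f g) h.
Proof.
move=> Hf Hg Hh; apply/funext => k.
pose a (x : int * int) := f x.1 * (g (x.2 - x.1) * h (k - x.2)).
have [l al] : exists l, has_sum abs a l.
  apply: (null_has_sum abs_na abs_cpl) => e e0.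
  have [F F1 fF] := Hset_gt1_bound Hf; have [G G1 gG] := Hset_gt1_bound Hg.
  have [J J1 hJ] := Hset_gt1_bound Hh.
  have [/HsetP[_ f0] /HsetP[_ g0] /HsetP[_ h0]] := And3 Hf Hg Hh.
  pose d := e / (F * G * J).
  have FG : 1 <= F * G by rewrite -(mulr1 1); apply: ler_pM.
  have FGJ : 1 <= F * G * J by rewrite -(mulr1 1); apply: ler_pM.
  have d0 : 0 < d by rewrite divr_gt0 //; lra.
  have [N1 fN] := f0 _ d0; have [N2 gN] := g0 _ d0; have [N3 hN] := h0 _ d0.
  pose B := (N1 + N2 + N3 + absz k)%N.
  exists [seq (i, j) | i <- zwindow B, j <- zwindow B] => -[i j] hij.
  rewrite /a /= !(nabsM abs_na).
  have prod3 (x y z X Y Z : R) : 0 <= x <= X -> 0 <= y <= Y -> 0 <= z <= Z ->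
      x * (y * z) <= X * (Y * Z).
    move=> /andP[? ?] /andP[? ?] /andP[? ?].
    by apply: ler_pM => //; [exact: mulr_ge0|apply: ler_pM].
  have de : d * (F * G * J) = e by rewrite /d divfK // gt_eqF //; lra.
  have bound x (X Y : R) : 0 <= x < d -> X * Y <= F * G * J -> 1 <= X * Y ->
      x * (X * Y) < e.
    move=> /andP[x0 xd] XY XY1; rewrite -de.
    apply: (@lt_le_trans _ _ (d * (X * Y))); first by rewrite ltr_pM2r //; lra.
    by rewrite ler_pM2l.
  have [a0 b0 c0] : [/\ forall x, 0 <= abs (f x) <= F, forall x, 0 <= abs (g x) <= G
      & forall x, 0 <= abs (h x) <= J].
    by split=> x; rewrite nabs_ge0 //=.
  have GJ : 1 <= G * J by rewrite -(mulr1 1); apply: ler_pM.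
  have FJ : 1 <= F * J by rewrite -(mulr1 1); apply: ler_pM.
  have [Ni|iN] := leP N1%:Z i.
    have := fN _ Ni => fi; apply: le_lt_trans (bound (abs (f i)) G J _ _ GJ).
    - by apply: (prod3 _ _ _ _ G J) => //; rewrite (nabs_ge0 abs_na) /= lexx.
    - by rewrite (nabs_ge0 abs_na).
    - by nra.
  have [Nj|jN] := leP N2%:Z (j - i).
    have := gN _ Nj => gj; apply: le_lt_trans (bound (abs (g (j - i))) F J _ _ FJ).
    - rewrite mulrCA.
      by apply: (prod3 _ _ _ _ F J) => //; rewrite (nabs_ge0 abs_na) /= lexx.
    - by rewrite (nabs_ge0 abs_na).
    - by nra.
  have [Nk|kN] := leP N3%:Z (k - j).
    have := hN _ Nk => hk; apply: le_lt_trans (bound (abs (h (k - j))) F G _ _ FG).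
    - rewrite mulrA mulrC.
      by apply: (prod3 _ _ _ _ F G) => //; rewrite (nabs_ge0 abs_na) /= lexx.
    - by rewrite (nabs_ge0 abs_na).
    - by nra.
  suff : (i, j) \in [seq (i, j) | i <- zwindow B, j <- zwindow B].
    by rewrite (negbTE hij).
  by apply: allpairs_f; rewrite mem_zwindow /B; lia.
have swapK : cancel (fun x : int * int => (x.2, x.1)) (fun x => (x.2, x.1)).
  by case.
transitivity l.
  apply/esym/(has_sum_fubini abs_na al _ (smul_has_sum k Hf (Hset_smul Hg Hh))) => i.
  suff hg : has_sum abs (fun j : int => g (j - i) * h (k - j))
      (smul abs g h (k - i)) by exact: (has_sumZ abs_na (f i) hg).
  have iK : cancel (fun j : int => j - i) (fun j => j + i) by move=> j; ring.
  have iK' : cancel (fun j : int => j + i) (fun j => j - i) by move=> j; ring.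
  have := has_sum_reindex iK iK' (smul_has_sum (k - i) Hg Hh).
  congr has_sum; apply/funext => j /=; congr (_ * h _); ring.
have := has_sum_reindex swapK swapK al => al'.
apply: (has_sum_fubini abs_na al' _ (smul_has_sum k (Hset_smul Hf Hg) Hh)) => j.
rewrite mulrC; have := has_sumZ abs_na (h (k - j)) (smul_has_sum j Hf Hg).
by congr has_sum; apply/funext => i; rewrite /a /=; ring.
Qed.

Lemma Hset_sconst c : Hset abs (sconst c).
Proof.
apply/HsetP; split.
  exists (abs c) => i; rewrite /sconst; case: eqP => // _.
  by rewrite (nabs0 abs_na) nabs_ge0.
move=> e e0; exists 1%N => i; rewrite /sconst; case: eqP => [->//|_ _].
by rewrite (nabs0 abs_na).
Qed.

Lemma smul_const f c : smul abs (sconst c) f = c *: f.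
Proof.
apply/funext => k; apply: smul_eq.
have -> : (c *: f) k = (fun i => sconst c i * f (k - i)) 0.
  by rewrite /sconst eqxx subr0.
apply: (has_sum1 abs_na) => j j0.
by rewrite /sconst (negbTE j0) mul0r.
Qed.

Lemma smulDl f g h : Hset abs f -> Hset abs g -> Hset abs h ->
  smul abs (f + g) h = smul abs f h + smul abs g h.
Proof.
move=> Hf Hg Hh; apply/funext => k; apply: smul_eq.
have := has_sumD abs_na (smul_has_sum k Hf Hh) (smul_has_sum k Hg Hh).
by congr has_sum; apply/funext => i; rewrite -mulrDl.
Qed.

Lemma smulZl c f g : Hset abs f -> Hset abs g ->
  smul abs (c *: f) g = c *: smul abs f g.
Proof.
move=> Hf Hg; apply/funext => k; apply: smul_eq.
have := has_sumZ abs_na c (smul_has_sum k Hf Hg).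
by congr has_sum; apply/funext => i; rewrite mulrA.
Qed.

Definition hpred : {pred zseries K} := fun h => `[< Hset abs h >].

Lemma hpred_submod : GRing.submod_closed hpred.
Proof.
split; first by apply/asboolP; have := Hset_sconst 0; congr Hset;
  apply/funext => i; rewrite /sconst if_same.
move=> c f g /asboolP/HsetP[[M fM] f0] /asboolP/HsetP[[M' gM] g0].
apply/asboolP/HsetP; split.
  exists (Num.max (abs c * M) M') => i; apply: (nabsD_le abs_na).
    by rewrite le_max (nabsM abs_na) ler_wpM2l // nabs_ge0.
  by rewrite le_max gM orbT.
move=> e e0; have ac : 0 < abs c + 1 by rewrite ltr_wpDl // nabs_ge0.
have [N fN] := f0 _ (divr_gt0 e0 ac).
have [N' gN] := g0 _ e0; exists (N + N')%N => i hi; apply: (nabsD_lt abs_na).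
  rewrite (nabsM abs_na); have /fN : N%:Z <= i by lia.
  rewrite ltr_pdivlMr // mulrC; apply: le_lt_trans.
  by rewrite ler_wpM2r ?nabs_ge0 // lerDl.
by apply: gN; lia.
Qed.

HB.instance Definition _ :=
  GRing.isSubmodClosed.Build K (zseries K) hpred hpred_submod.

(* The unused arguments tie the type to the hypotheses under which it is a ring. *)
Definition hring of nonarch_abs abs & abs_complete abs : Type :=
  {h : zseries K | hpred h}.

Local Notation H := (hring abs_na abs_cpl).

HB.instance Definition _ := SubChoice.on H.
HB.instance Definition _ := [SubChoice_isSubLmodule of H by <:].

Definition hmk h (Hh : Hset abs h) : H := Sub h (introT (asboolP _) Hh).

Lemma hringP (x : H) : Hset abs (val x).
Proof. exact/asboolP/(valP x). Qed.

Definition hmul (x y : H) : H := hmk (Hset_smul (hringP x) (hringP y)).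
Definition hone : H := hmk (Hset_sconst 1).

Lemma hmulA : associative hmul.
Proof. by move=> x y z; apply: val_inj; apply: smulA; exact: hringP. Qed.
Lemma hmulC : commutative hmul.
Proof. by move=> x y; apply: val_inj; apply: smulC; exact: hringP. Qed.
Lemma hmul1 : left_id hone hmul.
Proof.
by move=> x; apply: val_inj; rewrite [LHS]smul_const; exact: scale1r.
Qed.
Lemma hmulDl : left_distributive hmul +%R.
Proof. by move=> x y z; apply: val_inj; apply: smulDl; exact: hringP. Qed.
Lemma hone_neq0 : hone != 0.
Proof.
apply/eqP => /(congr1 (fun x : H => val x 0)) /eqP.
by rewrite [val _ _]/= /sconst eqxx oner_eq0.
Qed.

HB.instance Definition _ := GRing.Zmodule_isComNzRing.Build H
  hmulA hmulC hmul1 hmulDl hone_neq0.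

Lemma hscaleAl (c : K) (x y : H) : c *: (x * y) = c *: x * y.
Proof. by apply: val_inj; apply/esym/smulZl; exact: hringP. Qed.

HB.instance Definition _ := GRing.Lmodule_isLalgebra.Build K H hscaleAl.
HB.instance Definition _ := GRing.Lalgebra_isComAlgebra.Build K H.

End AnalyticRing.

(** * Exponentials in H *)

Lemma exists_expr_lt (R : realType) (t e : R) : 0 <= t < 1 -> 0 < e ->
  exists N : nat, forall n, (N <= n)%N -> t ^+ n < e.
Proof.
move=> /andP[t0 t1] e0; have t1' : `|t| < 1 by rewrite ger0_norm.
have /cvgrPdist_lt/(_ _ e0)[N _ hN] := cvg_expr t1'; exists N => n Nn.
by have := hN n Nn; rewrite sub0r normrN ger0_norm // exprn_ge0.
Qed.

Lemma sum_square_triangle (V : zmodType) (F : nat -> nat -> V) n :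
  \sum_(0 <= i < n) \sum_(0 <= j < n) F i j =
  \sum_(0 <= k < n) \sum_(0 <= i < k.+1) F i (k - i)%N +
  \sum_(0 <= i < n) \sum_(n - i <= j < n) F i j.
Proof.
have -> : \sum_(0 <= k < n) \sum_(0 <= i < k.+1) F i (k - i)%N =
    \sum_(0 <= i < n) \sum_(0 <= j < n - i) F i j.
  elim: n => [|n IH]; first by rewrite !big_nil.
  rewrite big_nat_recr //= IH [RHS]big_nat_recr //= subSnn big_nat1.
  rewrite big_nat_recr //= subnn addrA -big_split /=; congr (_ + _).
  apply: eq_big_nat => i /andP[_ ltin].
  by rewrite subSn 1?ltnW // big_nat_recr.
rewrite -big_split /=; apply: eq_big_nat => i /andP[_ ltin].
by rewrite -big_cat_nat // leq_subr.
Qed.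

Section Exponential.
Context (R : realType) (K : fieldType) (abs : K -> R).
Hypothesis abs_na : nonarch_abs abs.
Hypothesis abs_cpl : abs_complete abs.
Hypothesis char0 : forall k : nat, k.+1%:R != 0 :> K.
Local Notation H := (hring abs_na abs_cpl).
Implicit Types x y E F : H.

Lemma valM x y : val (x * y) = smul abs (val x) (val y). Proof. by []. Qed.
Lemma val1 : val (1 : H) = sconst 1. Proof. by []. Qed.

Lemma sexp_val x k : sexp abs (val x) k = val (x ^+ k).
Proof. by elim: k => // k IH; rewrite exprS valM -IH. Qed.

Definition bounded_by x (M : R) := forall i, abs (val x i) <= M.

Lemma bounded_byD x y M : bounded_by x M -> bounded_by y M -> bounded_by (x + y) M.
Proof. by move=> hx hy i; exact: (nabsD_le abs_na). Qed.

Lemma bounded_byN x M : bounded_by x M -> bounded_by (- x) M.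
Proof.
move=> hx i; have -> : val (- x) i = - val x i by [].
by rewrite (nabsN abs_na).
Qed.

Lemma bounded_byM x y M N : 0 <= M -> 0 <= N ->
  bounded_by x M -> bounded_by y N -> bounded_by (x * y) (M * N).
Proof.
move=> M0 N0 hx hy k; apply: (smul_le abs_na abs_cpl); try exact: hringP.
  exact: mulr_ge0.
by move=> i; rewrite (nabsM abs_na) ler_pM // (nabs_ge0 abs_na).
Qed.

Lemma bounded_byZ c x M N : 0 <= N ->
  abs c <= M -> bounded_by x N -> bounded_by (c *: x) (M * N).
Proof.
move=> N0 cM hx i; rewrite [val _ i]/(c * val x i) (nabsM abs_na).
by rewrite ler_pM // (nabs_ge0 abs_na).
Qed.

Lemma bounded_by0 M : 0 <= M -> bounded_by 0 M.
Proof. by move=> M0 i; rewrite [val _ i]/(0 : K) (nabs0 abs_na). Qed.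

Lemma bounded_by1 : bounded_by 1 1.
Proof.
move=> i; rewrite val1 /sconst; case: eqP => _; first by rewrite (nabs1 abs_na).
by rewrite (nabs0 abs_na).
Qed.

Lemma bounded_byX x k : bounded_by x 1 -> bounded_by (x ^+ k) 1.
Proof.
move=> hx; elim: k => [|k IH]; first exact: bounded_by1.
by rewrite exprS -(mulr1 (1 : R)); exact: bounded_byM.
Qed.

Lemma bounded_by_sum (I : Type) (r : seq I) (P : pred I) (F : I -> H) M :
  0 <= M -> (forall i, P i -> bounded_by (F i) M) ->
  bounded_by (\sum_(i <- r | P i) F i) M.
Proof.
move=> M0 hF; apply: (big_ind (fun x => bounded_by x M)) => //.
  exact: bounded_by0.
by move=> x y; exact: bounded_byD.
Qed.

Lemma bounded_by_le x M N : M <= N -> bounded_by x M -> bounded_by x N.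
Proof. by move=> MN hx i; exact: le_trans (hx i) MN. Qed.

Lemma Hnorm_le x M : bounded_by x M -> Hnorm abs (val x) <= M.
Proof.
move=> hx; apply: ge_sup; first by exists (abs (val x 0)), 0.
by move=> _ [i _ <-].
Qed.

Lemma Hnorm_ge x i : abs (val x i) <= Hnorm abs (val x).
Proof.
apply: ub_le_sup; last by exists i.
by have [[M hM] _] := hringP x; exists M => _ [j _ <-].
Qed.

Lemma bounded_by_eq0 x (t : R) : 0 <= t < 1 ->
  (forall n, bounded_by x (t ^+ n)) -> x = 0.
Proof.
move=> t01 hx; apply: val_inj; apply/funext => i.
apply/eqP; apply: contraT => xi; have xi0 := nabs_gt0 abs_na xi.
have [N hN] := exists_expr_lt t01 xi0.
by have := le_lt_trans (hx N i) (hN N (leqnn _)); rewrite ltxx.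
Qed.

Definition exp_term x k : H := k`!%:R^-1 *: x ^+ k.

Definition exp_sum x n : H := \sum_(0 <= k < n) exp_term x k.

Definition exp_dominated (t : R) x := forall k, bounded_by (exp_term x k) (t ^+ k).

Definition is_exp (t : R) x E := forall n, bounded_by (E - exp_sum x n) (t ^+ n).

Lemma exp_termD x y k :
  exp_term (x + y) k = \sum_(0 <= j < k.+1) exp_term x j * exp_term y (k - j).
Proof.
have fact0 m : m`!%:R != 0 :> K by rewrite -(prednK (fact_gt0 m)).
rewrite /exp_term addrC exprDn big_mkord scaler_sumr; apply: eq_bigr => -[j /=].
rewrite ltnS => jk _; rewrite -scalerAl -scalerAr scalerA -scaler_nat scalerA mulrC.
congr (_ *: _); last by rewrite mulrC.
rewrite -(bin_fact jk) !natrM !invfM; move: (fact0 j) (fact0 (k - j)%N) => j0 kj0.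
have c0 : 'C(k, j)%:R != 0 :> K.
  by apply: contraNneq (fact0 k) => c0; rewrite -(bin_fact jk) natrM c0 mul0r.
by field; rewrite j0 kj0.
Qed.

Lemma exp_sum_le t x n : 0 <= t <= 1 -> exp_dominated t x ->
  bounded_by (exp_sum x n) 1.
Proof.
move=> t01 hx; apply: bounded_by_sum => // k _; apply: bounded_by_le (hx k).
by case/andP: t01 => t0 t1; exact: exprn_ile1.
Qed.

Lemma is_exp_le1 t x E : is_exp t x E -> bounded_by E 1.
Proof. by move=> /(_ 0%N); rewrite /exp_sum big_nil subr0. Qed.

Lemma is_exp_unique t x E F : 0 <= t < 1 -> is_exp t x E -> is_exp t x F -> E = F.
Proof.
move=> t01 hE hF; apply/eqP; rewrite -subr_eq0; apply/eqP.
apply: (bounded_by_eq0 t01) => n.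
have -> : E - F = (E - exp_sum x n) - (F - exp_sum x n) by ring.
by apply: bounded_byD; last exact: bounded_byN.
Qed.

Lemma is_expD t x y E F : 0 <= t < 1 -> exp_dominated t x -> exp_dominated t y ->
  is_exp t x E -> is_exp t y F -> is_exp t (x + y) (E * F).
Proof.
move=> /andP[t0 t1] dx dy hE hF n.
have tn k : 0 <= t ^+ k by exact: exprn_ge0.
have t01 : 0 <= t <= 1 by rewrite t0 ltW.
pose D := \sum_(0 <= i < n) \sum_(n - i <= j < n) exp_term x i * exp_term y j.
have prodE : exp_sum x n * exp_sum y n = exp_sum (x + y) n + D.
  rewrite /exp_sum big_distrlr /= sum_square_triangle; congr (_ + _).
  by apply: eq_bigr => k _; rewrite exp_termD.
have -> : E * F - exp_sum (x + y) n = (E - exp_sum x n) * F +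
    exp_sum x n * (F - exp_sum y n) + D.
  by rewrite -[exp_sum (x + y) n](addrK D) -prodE; ring.
apply: bounded_byD; first apply: bounded_byD.
- rewrite -[t ^+ n]mulr1; apply: bounded_byM => //.
  exact: is_exp_le1 hF.
- rewrite -[t ^+ n]mul1r; apply: bounded_byM => //.
  exact: exp_sum_le dx.
rewrite /D big_seq; apply: bounded_by_sum => // i; rewrite mem_index_iota => hi.
rewrite big_seq; apply: bounded_by_sum => // j; rewrite mem_index_iota => hj.
apply: (@bounded_by_le _ (t ^+ i * t ^+ j)); last exact: bounded_byM.
by rewrite -exprD; apply: ler_wiXn2l => //; [exact: ltW|lia].
Qed.

Lemma is_exp0 t : 0 <= t -> is_exp t 0 1.
Proof.
move=> t0 [|n]; first by rewrite /exp_sum big_nil subr0; exact: bounded_by1.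
rewrite /exp_sum big_nat_recl // big1 => [|k _]; last first.
  by rewrite /exp_term expr0n /= scaler0.
rewrite /exp_term fact0 expr0 invr1 scale1r addr0 subrr.
by apply: bounded_by0; exact: exprn_ge0.
Qed.

Lemma exp_dominatedN t x : exp_dominated t x -> exp_dominated t (- x).
Proof.
move=> dx k; rewrite /exp_term exprNn -signr_odd.
case: odd; rewrite ?expr1 ?expr0 ?mulN1r ?mul1r ?scalerN; last exact: dx.
by apply: bounded_byN; exact: dx.
Qed.

Lemma is_exp_inv t x E F : 0 <= t < 1 -> exp_dominated t x ->
  is_exp t x E -> is_exp t (- x) F -> E * F = 1.
Proof.
move=> t01 dx hE hF; have := is_expD t01 dx (exp_dominatedN dx) hE hF.
rewrite subrr => h; apply: (is_exp_unique t01 h); apply: is_exp0.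
by case/andP: t01.
Qed.

Lemma exists_exp t x : 0 <= t < 1 -> exp_dominated t x -> exists E, is_exp t x E.
Proof.
move=> t01 dx; have /andP[t0 t1] := t01.
have tn k : 0 <= t ^+ k by exact: exprn_ge0.
have dist m n i : (n <= m)%N ->
    abs (val (exp_sum x m) i - val (exp_sum x n) i) <= t ^+ n.
  move=> nm; suff : bounded_by (exp_sum x m - exp_sum x n) (t ^+ n) by exact.
  rewrite /exp_sum (big_cat_nat (leq0n n) nm) /=.
  rewrite addrAC subrr add0r big_seq.
  apply: bounded_by_sum => // k; rewrite mem_index_iota => /andP[nk _].
  apply: bounded_by_le (dx k); apply: ler_wiXn2l => //; exact: ltW.
have /choice[E hE] : forall i, exists l, abs_cvg abs (fun n => val (exp_sum x n) i) l.
  move=> i; apply: abs_cpl => e /(exists_expr_lt t01)[N hN]; exists N => m n Nm Nn.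
  apply: le_lt_trans (hN N (leqnn _)).
  apply: (nabs_dist_le abs_na (z := val (exp_sum x N) i)); first exact: dist.
  by rewrite (nabs_distC abs_na); exact: dist.
have near_E n i : abs (E i - val (exp_sum x n) i) <= t ^+ n.
  apply: (abs_cvg_le abs_na (u := fun m => val (exp_sum x m) i - val (exp_sum x n) i)).
    apply/(abs_cvgP abs_na) => e e0.
    have /(abs_cvgP abs_na)/(_ _ e0)[N hN] := hE i; exists N => m /hN.
    by congr (abs _ < e); ring.
  by exists n => m; exact: dist.
have HE : Hset abs E.
  apply/HsetP => //; split.
    exists 1 => i; have := near_E 0%N i; rewrite /exp_sum big_nil.
    by rewrite [val _ i]/(0 : K) subr0.
  move=> e e0; have [n hn] := exists_expr_lt t01 e0.
  have /(HsetP abs_na)[_ /(_ _ e0)[N hN]] := hringP (exp_sum x n).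
  exists N => i Ni; rewrite -(subrK (val (exp_sum x n) i) (E i)).
  apply: (nabsD_lt abs_na); last exact: hN.
  exact: le_lt_trans (near_E n i) (hn n (leqnn _)).
by exists (hmk abs_na abs_cpl HE) => n i; exact: near_E.
Qed.

Definition deg_le (N : nat) x := forall i : int, N%:Z < i -> val x i = 0.

Lemma deg_leM m n x y : deg_le m x -> deg_le n y -> deg_le (m + n) (x * y).
Proof.
move=> hx hy k hk; rewrite valM.
apply: (smul_eq abs_na); apply: (has_sum0 abs_na) => i.
have [mi|im] := ltP m%:Z i; first by rewrite hx ?mul0r.
by rewrite [val y _]hy ?mulr0 //; lia.
Qed.

Lemma deg_le_trans m n x : (m <= n)%N -> deg_le m x -> deg_le n x.
Proof. by move=> mn hx i hi; apply: hx; lia. Qed.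

Lemma deg_le_exp_term N x k : deg_le N x -> deg_le (k * N) (exp_term x k).
Proof.
move=> hx; suff hX : deg_le (k * N) (x ^+ k).
  move=> i hi; rewrite [val _ i]/(k`!%:R^-1 * val (x ^+ k) i) (hX i hi).
  exact: mulr0.
elim: k => [|k IH]; last by rewrite exprS mulSn; exact: deg_leM.
by move=> i hi; rewrite expr0 val1 /sconst; case: eqP => // i0; exfalso; lia.
Qed.

Lemma deg_le_exp_sum N x n : deg_le N x -> deg_le (n.-1 * N) (exp_sum x n).
Proof.
move=> hx; rewrite /exp_sum big_seq; apply: (big_ind (deg_le _)) => //.
  move=> y z hy hz i hi; rewrite [val _ i]/(val y i + val z i) hy ?hz //.
  exact: addr0.
move=> k; rewrite mem_index_iota => hk; apply: (@deg_le_trans (k * N)).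
  rewrite leq_mul2r; apply/orP; right; lia.
exact: deg_le_exp_term.
Qed.

Lemma is_exp_coef0 t x E : 0 <= t < 1 -> is_exp t x E -> abs (val E 0) = 1.
Proof.
move=> /andP[t0 t1] /(_ 1%N 0).
have -> : exp_sum x 1 = 1 by rewrite /exp_sum big_nat1 /exp_term fact0 invr1 scale1r.
have -> : val (E - 1) 0 = val E 0 - 1.
  by rewrite [LHS]/(val E 0 - sconst 1 0) /sconst eqxx.
rewrite expr1 => hE; rewrite -(nabs1 abs_na); apply: (nabs_eq_of_lt abs_na).
by rewrite (nabs1 abs_na); exact: le_lt_trans hE t1.
Qed.

Lemma is_exp_coef_le t N x E i n : 0 <= t -> deg_le N x -> is_exp t x E ->
  (0 < i)%N -> (n.-1 * N < i)%N -> abs (val E i%:Z) <= t ^+ n.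
Proof.
move=> t0 hx hE i0 ni; have := hE n i%:Z.
rewrite [val _ _]/(val E i%:Z - val (exp_sum x n) i%:Z).
have -> : val (exp_sum x n) i%:Z = 0 by apply: deg_le_exp_sum hx _ _; rewrite ltz_nat.
by rewrite [X in abs X](subr0 (val E i%:Z : K)).
Qed.

Lemma exists_root_bound (t : R) (N : nat) : 0 <= t < 1 -> (0 < N)%N ->
  exists2 r : R, 0 <= r < 1 & t <= r ^+ N.
Proof.
move=> /andP[t0 t1] N0.
exists (t `^ N%:R^-1).
  rewrite powR_ge0 /= -[ltRHS](congr1 (fun f => f N%:R^-1) (@powR1 R)).
  by apply: gt0_ltr_powR; rewrite ?nnegrE // invr_gt0 ltr0n.
by rewrite -powR_mulrn ?powR_ge0 // -powRrM mulVf ?powRr1 // pnatr_eq0 -lt0n.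
Qed.

Lemma units_hring B (E F : H) : B (val E) -> B (val F) -> E * F = 1 ->
  units abs B (val E).
Proof. by move=> BE BF EF; split=> //; exists (val F) => //; rewrite -valM EF. Qed.

Lemma Gamma_exp t N (r : R) x E F : 0 <= t < 1 -> exp_dominated t x ->
  deg_le N x -> is_exp t x E -> is_exp t (- x) F ->
  0 <= r -> (N = 0%N \/ t <= r ^+ N /\ r <= 1) -> Gamma_ abs r (val E).
Proof.
move=> t01 dx hx hE hF r0 hr; have /andP[t0 t1] := t01; split.
- by apply: units_hring (is_exp_inv t01 dx hE hF); exact: hringP.
- apply/eqP; rewrite eq_le; apply/andP; split.
    by apply: Hnorm_le; exact: is_exp_le1 hE.
  by rewrite -(is_exp_coef0 t01 hE) Hnorm_ge.
- exact: is_exp_coef0 hE.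
move=> i i0; have [N0|N0] := posnP N.
  suff -> : val E i = 0 by rewrite (nabs0 abs_na) exprn_ge0.
  apply/eqP; apply: contraT => /(nabs_gt0 abs_na)/(exists_expr_lt t01)[n hn].
  have := is_exp_coef_le (n := n) t0 hx hE i0; rewrite N0 muln0 => /(_ i0).
  by rewrite leNgt hn.
case: hr => [hN|[tr r1]]; first by rewrite hN in N0.
pose n := (i.-1 %/ N).+1.
have hn : (i <= N * n)%N by rewrite /n; have := ltn_ceil i.-1 N0; nia.
apply: le_trans (is_exp_coef_le (n := n) t0 hx hE i0 _) _.
  by rewrite /n /=; have := leq_trunc_div i.-1 N; lia.
apply: (@le_trans _ _ ((r ^+ N) ^+ n)).
  by apply: lerXn2r; rewrite ?nnegrE ?exprn_ge0.
by rewrite -exprM; exact: ler_wiXn2l.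
Qed.

Lemma Gamma_mul r (E F : H) : 0 <= r < 1 ->
  Gamma_ abs r (val E) -> Gamma_ abs r (val F) -> Gamma_ abs r (val (E * F)).
Proof.
move=> /andP[r0 r1] [[_ [E' HE' EE']] nE E0 Er] [[_ [F' HF' FF']] nF F0 Fr].
have r1W := ltW r1.
have E1 i : abs (val E i) <= 1 by rewrite -nE Hnorm_ge.
have F1 i : abs (val F i) <= 1 by rewrite -nF Hnorm_ge.
have coef0 : abs (val (E * F) 0) = 1.
  have d : abs (val (E * F) 0 - val E 0 * val F 0) <= r.
    have h := smul_has_sum abs_na abs_cpl 0 (hringP E) (hringP F).
    pose a0 (i : int) := if i == 0 then - (val E 0 * val F 0) else 0.
    have h0 : has_sum abs a0 (- (val E 0 * val F 0)).
      have -> : - (val E 0 * val F 0) = a0 0 by [].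
      by apply: (has_sum1 abs_na) => j /negbTE j0; rewrite /a0 j0.
    apply: (has_sum_le abs_na r0 _ (has_sumD abs_na h h0)) => i.
    rewrite /a0; have [->|i0] := eqVneq i 0.
      by rewrite sub0r oppr0 subrr (nabs0 abs_na).
    rewrite addr0 sub0r (nabsM abs_na); case: i i0 => [[//|i]|i] _.
      rewrite -[r]mulr1; apply: ler_pM; rewrite ?(nabs_ge0 abs_na) //.
      apply: le_trans (Er _ _) _ => //.
      by rewrite exprS; apply: ler_piMr => //; exact: exprn_ile1.
    rewrite -[r]mul1r; apply: ler_pM; rewrite ?(nabs_ge0 abs_na) //.
    rewrite NegzE opprK; apply: le_trans (Fr _ _) _ => //.
    by rewrite exprS; apply: ler_piMr => //; exact: exprn_ile1.
  have EF1 : abs (val E 0 * val F 0) = 1 by rewrite (nabsM abs_na) E0 F0 mulr1.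
  rewrite -EF1; apply: (nabs_eq_of_lt abs_na); rewrite EF1.
  exact: le_lt_trans d r1.
split=> //.
- apply: (units_hring (hringP _) (hringP _)
    (F := hmk abs_na abs_cpl HE' * hmk abs_na abs_cpl HF')).
  rewrite mulrACA; have -> : E * hmk abs_na abs_cpl HE' = 1 by exact: val_inj.
  by rewrite mul1r; exact: val_inj.
- apply/eqP; rewrite eq_le; apply/andP; split; last by rewrite -coef0 Hnorm_ge.
  by apply: Hnorm_le; rewrite -(mulr1 (1 : R)); apply: bounded_byM => //.
move=> k k0; apply: (smul_le abs_na abs_cpl); try exact: hringP.
  exact: exprn_ge0.
have rle (i : nat) : (k <= i)%N -> r ^+ i <= r ^+ k.
  by move=> ki; apply: ler_wiXn2l => //; exact: ltW.
have pow (G : H) (hG : forall i : nat, (0 < i)%N -> abs (val G i%:Z) <= r ^+ i)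
    (i : int) : k%:Z <= i -> abs (val G i) <= r ^+ k.
  case: i => // i ki; apply: le_trans (hG _ _) (rle _ ki); lia.
move=> i; rewrite (nabsM abs_na).
have [ki|ik] := leP k%:Z i.
  rewrite -[r ^+ k]mulr1; apply: ler_pM; rewrite ?(nabs_ge0 abs_na) //.
  exact: pow.
have [i0|i0] := leP i 0.
  rewrite -[r ^+ k]mul1r; apply: ler_pM; rewrite ?(nabs_ge0 abs_na) //.
  by apply: pow => //; lia.
case: i i0 ik => // i i0 ik.
have -> : k%:Z - i%:Z = (k - i)%N by lia.
have -> : r ^+ k = r ^+ i * r ^+ (k - i) by rewrite -exprD; congr (_ ^+ _); lia.
by apply: ler_pM; rewrite ?(nabs_ge0 abs_na) // ?Er ?Fr //; lia.
Qed.

Lemma Gamma_le (r r' : R) h : 0 <= r -> r <= r' -> Gamma_ abs r h -> Gamma_ abs r' h.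
Proof.
move=> r0 rr' [u n1 c0 hc]; split=> // i i0; apply: le_trans (hc i i0) _.
by apply: lerXn2r; rewrite ?nnegrE //; exact: le_trans r0 rr'.
Qed.

Lemma Gamma_hring h : Gamma abs h -> Hset abs h.
Proof. by case=> r _ [[]]. Qed.

Lemma GammaM (E F : H) : Gamma abs (val E) -> Gamma abs (val F) ->
  Gamma abs (val (E * F)).
Proof.
move=> [r /andP[r0 r1] Er] [r' /andP[r'0 r'1] Fr].
exists (Num.max r r'); first by rewrite le_max r0 gt_max r1.
apply: Gamma_mul; first by rewrite le_max r0 gt_max r1.
  by apply: Gamma_le Er; rewrite // le_max lexx.
by apply: Gamma_le Fr; rewrite // le_max lexx orbT.
Qed.

End Exponential.

(** * The group Gamma_A *)

Section ClassGroup.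
Context (R : realType) (K : fieldType) (abs : K -> R).
Hypothesis abs_na : nonarch_abs abs.
Hypothesis abs_cpl : abs_complete abs.
Hypothesis char0 : forall k : nat, k.+1%:R != 0 :> K.
Variable A : set (zseries K).
Hypothesis A_alg : is_subalgebra abs A.
Local Notation H := (hring abs_na abs_cpl).
Implicit Types x y E F : H.

Lemma HclosureP E : Hclosure abs A (val E) <->
  forall e : R, 0 < e -> exists2 f : H, A (val f) & bounded_by (E - f) e.
Proof.
split=> [[_ hE] e /hE[f [Af Hf] fe]|hE].
  exists (hmk abs_na abs_cpl Hf) => // i.
  by apply: le_trans (ltW fe); exact: (Hnorm_ge (E - hmk abs_na abs_cpl Hf)).
split; first exact: hringP.
move=> e e0; have [f Af fe] := hE (e / 2) ltac:(lra).
exists (val f); first by split=> //; exact: hringP.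
by apply: le_lt_trans (Hnorm_le fe) _; lra.
Qed.

Lemma HclosureM E F : Hclosure abs A (val E) -> Hclosure abs A (val F) ->
  Hclosure abs A (val (E * F)).
Proof.
move=> /HclosureP hE /HclosureP hF; apply/HclosureP => e e0.
have [M M1 EM] := Hset_gt1_bound (hringP E).
have [f Af Ef] := hE 1 ltr01.
have [M' M'1 fM] : exists2 M' : R, 1 <= M' & bounded_by f M'.
  by have [M' ? ?] := Hset_gt1_bound (hringP f); exists M'.
have [N N1 FN] := Hset_gt1_bound (hringP F).
pose L := Num.max M (Num.max 1 N).
have [L1 ML NL] : [/\ 1 <= L, M <= L & N <= L].
  by rewrite /L !le_max !lexx ?orbT.
have L0 : 0 < L by lra.
have d0 : 0 < Num.min 1 (e / L) by rewrite lt_min ltr01 divr_gt0.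
have [d1 dL] : Num.min 1 (e / L) <= 1 /\ Num.min 1 (e / L) * L <= e.
  by split; [rewrite ge_min lexx|rewrite -ler_pdivlMr // ge_min lexx orbT].
set d := Num.min 1 (e / L) in d0 d1 dL.
have [f' Af' Ef'] := hE d d0; have [g Ag Fg] := hF d d0.
exists (f' * g); first by case: A_alg => _ _ _ _; apply.
have -> : E * F - f' * g = (E - f') * F + f' * (F - g) by ring.
have f'L : bounded_by f' L.
  have -> : f' = E - (E - f') by ring.
  apply: (bounded_byD (x := E)); first by apply: bounded_by_le ML _ .
  by apply: bounded_byN; apply: bounded_by_le Ef'; lra.
apply: (bounded_by_le dL); apply: bounded_byD.
  by apply: bounded_byM => //; [exact: ltW|exact: ltW|exact: bounded_by_le FN].
by rewrite mulrC; apply: bounded_byM => //; exact: ltW.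
Qed.

Lemma Hclosure_exp t x E : 0 <= t < 1 -> A (val x) -> is_exp t x E ->
  Hclosure abs A (val E).
Proof.
move=> t01 Ax hE; have [_ A1 AD AZ AM] := A_alg.
have AX k : A (val (x ^+ k)).
  by elim: k => [|k IH]; [exact: A1|rewrite exprS; exact: AM].
have A0 : A 0 by rewrite -(scale0r (sconst 1)); exact: AZ.
apply/HclosureP => e /(exists_expr_lt t01)[n hn].
exists (exp_sum x n); last by apply: bounded_by_le (hE n); exact/ltW/hn.
apply: (big_ind (fun y : H => A (val y))) => // [y z|k _]; first exact: AD.
exact: AZ.
Qed.

Lemma units_HclosureM E F : units abs (Hclosure abs A) (val E) ->
  units abs (Hclosure abs A) (val F) -> units abs (Hclosure abs A) (val (E * F)).
Proof.
move=> [AE [E' AE' EE']] [AF [F' AF' FF']].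
have [[HE' _] [HF' _]] := (AE', AF').
pose E'' : H := hmk abs_na abs_cpl HE'; pose F'' : H := hmk abs_na abs_cpl HF'.
apply: (units_hring (F := E'' * F'')); try exact: HclosureM.
rewrite mulrACA; have -> : E * E'' = 1 by exact: val_inj.
by rewrite mul1r; exact: val_inj.
Qed.

Lemma GammaA_kernelP h : GammaA_kernel abs A h <-> exists u g : H,
  [/\ (units abs (Hclosure abs A) `&` Gamma abs) (val u), Gamma_ abs 0 (val g)
    & h = val (u * g)].
Proof.
split=> [[u [uu Gu] [g Gg ->]]|[u [g [hu hg ->]]]].
  have Hg : Hset abs g by case: Gg => -[].
  by exists (hmk abs_na abs_cpl (Gamma_hring Gu)), (hmk abs_na abs_cpl Hg).
by exists (val u) => //; exists (val g).
Qed.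

Lemma GammaA_kernelM E F : GammaA_kernel abs A (val E) ->
  GammaA_kernel abs A (val F) -> GammaA_kernel abs A (val (E * F)).
Proof.
move=> /GammaA_kernelP[u [g [[Au Gu] Gg /val_inj ->]]].
move=> /GammaA_kernelP[v [h [[Av Gv] Gh /val_inj ->]]].
apply/GammaA_kernelP; exists (u * v), (g * h); split; last by rewrite mulrACA.
  by split; [exact: units_HclosureM|exact: GammaM].
by apply: Gamma_mul; rewrite ?lexx ?ltr01.
Qed.

Lemma GammaA_class_eq1 E F : E * F = 1 -> GammaA_kernel abs A (val E) ->
  GammaA_kernel abs A (val F) ->
  GammaA_class abs A (val E) = GammaA_class abs A (sconst 1).
Proof.
move=> EF kE kF; apply/seteqP; split=> h [k kk <-].
  have [u [g [_ _ kug]]] := (GammaA_kernelP k).1 kk.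
  exists (val (E * (u * g))); last by rewrite (smul_const abs_na) scale1r kug.
  by apply: GammaA_kernelM; rewrite -?kug.
have [u [g [_ _ kug]]] := (GammaA_kernelP k).1 kk.
exists (val (F * (u * g))); first by apply: GammaA_kernelM; rewrite -?kug.
by rewrite -valM mulrA EF mul1r (smul_const abs_na) scale1r kug.
Qed.

Lemma GammaA_kernel_exp t N x y E F : 0 <= t < 1 ->
  exp_dominated t x -> exp_dominated t y -> deg_le N x -> deg_le 0 y -> A (val x) ->
  is_exp t x E -> is_exp t y F -> GammaA_kernel abs A (val (E * F)).
Proof.
move=> t01 dx dy Nx Ny Ax hE hF; have /andP[t0 t1] := t01.
have [E' hE'] := exists_exp t01 (exp_dominatedN dx).
have [F' hF'] := exists_exp t01 (exp_dominatedN dy).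
have Nx' : deg_le N.+1 x by move=> i hi; apply: Nx; lia.
have [r /andP[r0 r1] tr] := exists_root_bound t01 (ltn0Sn N).
have AxN : A (val (- x)).
  by have [_ _ _ AZ _] := A_alg; rewrite -scaleN1r; apply: (AZ (-1)).
apply/GammaA_kernelP; exists E, F; split=> //; last first.
  by apply: (Gamma_exp char0 t01 dy Ny hF hF') => //; left.
split; last first.
  exists r; first by rewrite r0.
  by apply: (Gamma_exp char0 t01 dx Nx' hE hE') => //; right; split=> //; exact: ltW.
apply: units_hring (is_exp_inv char0 t01 dx hE hE').
  exact: Hclosure_exp t01 Ax hE.
exact: Hclosure_exp t01 AxN hE'.
Qed.

Lemma GammaA_kernel_Gamma E : GammaA_kernel abs A (val E) -> Gamma abs (val E).
Proof.
move=> /GammaA_kernelP[u [g [[_ Gu] Gg ->]]]; apply: GammaM => //.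
by exists 0; rewrite // lexx ltr01.
Qed.

Lemma exp_dominatedZ (d : K) t x : bounded_by x 1 ->
  (forall k, abs (d ^+ k / k`!%:R) <= t ^+ k) -> exp_dominated t (d *: x).
Proof.
move=> x1 dt k; rewrite /exp_term exprZn scalerA -[t ^+ k]mulr1 mulrC.
by apply: bounded_byZ => //; exact: bounded_byX.
Qed.

Lemma Hset_laurent f : laurent f -> (forall i, abs (f i) <= 1) -> Hset abs f.
Proof.
move=> [n fn] f1; apply/(HsetP abs_na); split; first by exists 1.
move=> e e0; exists (absz n).+1 => i ni; rewrite fn ?(nabs0 abs_na) //; lia.
Qed.

Lemma exp_class_trivial (d : K) t b : 0 <= t < 1 ->
  (forall k, abs (d ^+ k / k`!%:R) <= t ^+ k) -> OA_plus_tail abs A b ->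
  exists E : zseries K, [/\ is_Hexp abs (d *: b) E, Gamma abs E &
    GammaA_class abs A E = GammaA_class abs A (sconst 1)].
Proof.
move=> t01 dt [a [g [[Aa a1] [g0 g1] ->]]].
have [Alau _ _ AZ _] := A_alg.
have Ha : Hset abs a by exact: Hset_laurent (Alau _ Aa) a1.
have Hg : Hset abs g.
  by apply: Hset_laurent g1; exists 0 => i /ltW; exact: g0.
pose x : H := d *: hmk abs_na abs_cpl Ha; pose y : H := d *: hmk abs_na abs_cpl Hg.
have dx : exp_dominated t x by exact: exp_dominatedZ.
have dy : exp_dominated t y by exact: exp_dominatedZ.
have [N Nx] : exists N, deg_le N x.
  have [n an] := Alau _ Aa; exists (absz n) => i ni.
  have ai0 : a i = 0 by apply: an; lia.
  by rewrite [val x i]/(d * a i) ai0; exact: mulr0.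
have Ny : deg_le 0 y.
  by move=> i /ltW/g0 gi0; rewrite [val y i]/(d * g i) gi0; exact: mulr0.
have Ax : A (val x) by exact: AZ.
have [[E hE] [F hF]] := (exists_exp t01 dx, exists_exp t01 dy).
have [E' hE'] := exists_exp t01 (exp_dominatedN dx).
have [F' hF'] := exists_exp t01 (exp_dominatedN dy).
have kE : GammaA_kernel abs A (val (E * F)).
  exact: GammaA_kernel_exp dx dy Nx Ny _ hE hF.
have NxN : deg_le N (- x).
  by move=> i Ni; rewrite [val _ i]/(- val x i) (Nx i Ni); exact: oppr0.
have NyN : deg_le 0 (- y).
  by move=> i Ni; rewrite [val _ i]/(- val y i) (Ny i Ni); exact: oppr0.
have AxN : A (val (- x)) by rewrite -scaleN1r; apply: (AZ (-1)).
have kE' : GammaA_kernel abs A (val (E' * F')).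
  exact: GammaA_kernel_exp (exp_dominatedN dx) (exp_dominatedN dy) NxN NyN _ hE' hF'.
exists (val (E * F)); split.
- split; first exact: hringP.
  have -> : d *: (a + g) = val (x + y) by rewrite scalerDr.
  have hEF := is_expD char0 t01 dx dy hE hF.
  apply/cvgrPdist_lt => e /(exists_expr_lt t01)[n hn]; exists n => // m /= nm.
  have -> : \sum_(k < m) (k`!%:R)^-1 *: sexp abs (val (x + y)) k =
      val (exp_sum (x + y) m).
    rewrite /exp_sum big_mkord raddf_sum; apply: eq_bigr => k _.
    by rewrite sexp_val.
  have -> : val (exp_sum (x + y) m) - val (E * F) =
    val (exp_sum (x + y) m - E * F) by [].
  have EFm : bounded_by (exp_sum (x + y) m - E * F) (t ^+ m).
    by rewrite -opprB; apply: bounded_byN; exact: hEF.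
  rewrite sub0r normrN ger0_norm; last first.
    exact: le_trans (nabs_ge0 abs_na _) (Hnorm_ge _ 0).
  by apply: le_lt_trans (Hnorm_le EFm) _; exact: hn.
- exact: GammaA_kernel_Gamma.
apply: (@GammaA_class_eq1 _ (E' * F')) => //.
rewrite mulrACA (is_exp_inv char0 t01 dx hE hE').
by rewrite (is_exp_inv char0 t01 dy hF hF') mul1r.
Qed.

End ClassGroup.

(** * p-adic estimates *)

Section FiniteExtension.
Context (R : realType) (F : fieldType) (absF : F -> R).
Context (L : fieldExtType F) (abs : L -> R).
Hypothesis F_cpl : abs_complete absF.
Hypothesis habs : extends_abs absF abs.

Let abs_na : nonarch_abs abs := habs.1.

Lemma nabsZ (c : F) (v : L) : abs (c *: v) = absF c * abs v.
Proof. by rewrite -mulr_algl (nabsM abs_na) habs.2. Qed.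

Definition vspace_complete (V : {vspace L}) := forall u : nat -> L,
  (forall n, u n \in V) -> abs_cauchy abs u -> exists2 l, l \in V & abs_cvg abs u l.

Lemma vspace_dist_gt0 (V : {vspace L}) e : vspace_complete V -> e \notin V ->
  exists2 d : R, 0 < d & forall v, v \in V -> d <= abs (e - v).
Proof.
move=> cV eV; apply: contrapT => nd.
have /choice[v hv] : forall n : nat, exists v, v \in V /\ abs (v - e) < n.+1%:R^-1.
  move=> n; apply: contrapT => nv; apply: nd; exists n.+1%:R^-1.
    by rewrite invr_gt0.
  move=> v Vv; rewrite leNgt; apply/negP => lt_ev; apply: nv; exists v.
  by rewrite (nabs_distC abs_na).
have ve : abs_cvg abs v e.
  apply/(abs_cvgP abs_na) => d /exists_inv_natS_lt[N Nd]; exists N => n Nn.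
  apply: lt_trans (hv n).2 _; apply: le_lt_trans Nd.
  by rewrite lef_pV2 ?posrE // ler_nat ltnS.
have [l Vl vl] := cV v (fun n => (hv n).1) (abs_cvg_cauchy abs_na ve).
by rewrite (abs_cvg_unique abs_na ve vl) Vl in eV.
Qed.

Lemma vspace_complete_add1 (V : {vspace L}) e :
  vspace_complete V -> vspace_complete (<[e]> + V).
Proof.
move=> cV; have [eV|eV] := boolP (e \in V).
  by have /addv_idPr -> : (<[e]> <= V)%VS by rewrite -memvE.
have [d d0 dV] := vspace_dist_gt0 cV eV.
move=> u uV cu.
have /choice[xv hxv] : forall n, exists xv : F * L,
    xv.2 \in V /\ u n = xv.1 *: e + xv.2.
  move=> n; have /memv_addP[_ /vlineP[x ->] [v Vv uE]] := uV n.
  by exists (x, v).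
pose x n := (xv n).1; pose v n := (xv n).2.
have uE n : u n = x n *: e + v n by case: (hxv n).
have Vv n : v n \in V by case: (hxv n).
have xu m n : d * absF (x m - x n) <= abs (u m - u n).
  have uB : u m - u n = (x m - x n) *: e + (v m - v n).
    by rewrite !uE scalerBl opprD addrACA.
  have [xE|xmn] := eqVneq (x m - x n) 0.
    by rewrite xE -(habs.2 0) scale0r (nabs0 abs_na) mulr0 (nabs_ge0 abs_na).
  have {}uB : u m - u n =
      (x m - x n) *: (e - (- ((x m - x n)^-1 *: (v m - v n)))).
    by rewrite opprK scalerDr scalerA mulfV // scale1r.
  rewrite uB nabsZ mulrC ler_wpM2l //.
    by rewrite -(habs.2 _) (nabs_ge0 abs_na).
  by apply: dV; rewrite memvN memvZ // memvB.
have [x0 xx0] : exists x0, abs_cvg absF x x0.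
  apply: F_cpl => r r0; have [N hN] := cu _ (mulr_gt0 d0 r0).
  exists N => m n Nm Nn; rewrite -(ltr_pM2l d0).
  exact: le_lt_trans (xu m n) (hN m n Nm Nn).
have xe : abs_cvg abs (fun n => x n *: e) (x0 *: e).
  apply/(abs_cvgP abs_na) => r r0.
  have e1 : 0 < abs e + 1 by rewrite ltr_wpDl // (nabs_ge0 abs_na).
  have /cvgrPdist_lt/(_ _ (divr_gt0 r0 e1))[N _ hN] := xx0.
  exists N => n /hN; rewrite sub0r normrN.
  have a0 : 0 <= absF (x n - x0) by rewrite -(habs.2 _) (nabs_ge0 abs_na).
  rewrite ger0_norm // ltr_pdivlMr // -scalerBl nabsZ; apply: le_lt_trans.
  by rewrite ler_wpM2l // lerDl.
have cv : abs_cauchy abs v.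
  move=> r r0; have [N hN] := cu r r0.
  have [N' hN'] := abs_cvg_cauchy abs_na xe r0.
  exists (maxn N N') => m n; rewrite !geq_max => /andP[Nm N'm] /andP[Nn N'n].
  have -> : v m - v n = (u m - u n) - (x m *: e - x n *: e) by rewrite !uE; ring.
  by apply: (nabsB_lt abs_na); [exact: hN|exact: hN'].
have [v0 Vv0 vv0] := cV v Vv cv.
exists (x0 *: e + v0); first by rewrite memv_add // memvZ // memv_line.
apply/(abs_cvgP abs_na) => r r0.
have /(abs_cvgP abs_na)/(_ _ r0)[N hN] := vv0.
have /(abs_cvgP abs_na)/(_ _ r0)[N' hN'] := xe.
exists (maxn N N') => n; rewrite geq_max => /andP[Nn N'n].
have -> : u n - (x0 *: e + v0) = (x n *: e - x0 *: e) + (v n - v0).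
  by rewrite uE; ring.
by apply: (nabsD_lt abs_na); [exact: hN'|exact: hN].
Qed.

Lemma fieldExt_complete : abs_complete abs.
Proof.
suff cs (s : seq L) : vspace_complete (span s).
  move=> u cu; have uf n : u n \in <<vbasis {:L}>>%VS.
    by rewrite (span_basis (vbasisP _)) memvf.
  by have [l _ ul] := cs _ u uf cu; exists l.
elim: s => [|e s IH]; last by rewrite span_cons; exact: vspace_complete_add1.
rewrite span_nil => u u0 _; exists 0; first exact: mem0v.
apply/(abs_cvgP abs_na) => r r0; exists 0%N => n _.
by have /eqP -> := etrans (esym (memv0 _)) (u0 n); rewrite subr0 (nabs0 abs_na).
Qed.

End FiniteExtension.

Lemma logn_fact_le p k : prime p -> (p.-1 * logn p k`! <= k)%N.
Proof.
move=> p_pr; rewrite (logn_fact _ p_pr).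
suff h m j : (p.-1 * \sum_(1 <= i < m.+1) j %/ p ^ i <= j)%N by exact: h.
elim: m j => [|m IH] j; first by rewrite big_geq ?muln0.
rewrite big_nat_recl // expn1.
have -> : (\sum_(1 <= i < m.+1) j %/ p ^ i.+1 =
    \sum_(1 <= i < m.+1) (j %/ p) %/ p ^ i)%N.
  by apply: eq_bigr => i _; rewrite expnS divnMA.
rewrite mulnDr; apply: leq_trans (leq_trunc_div j p).
have := IH (j %/ p)%N; have := prime_gt1 p_pr; nia.
Qed.

Lemma bernoulli_expn p j : (0 < p -> 1 + j * p.-1 <= p ^ j)%N.
Proof.
move=> p0; elim: j => // j IH; rewrite expnS.
have : (1 <= p ^ j)%N by rewrite expn_gt0 p0.
nia.
Qed.

Lemma natr_expr_le (R : realFieldType) (s : R) m : 0 <= s <= 1 ->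
  m%:R * s ^+ m * (1 - s) <= 1 - s ^+ m.
Proof.
move=> /andP[s0 s1]; elim: m => [|m IH]; first by rewrite !mul0r expr0 subrr.
have sm1 : s ^+ m.+1 <= 1 by exact: exprn_ile1.
have sIH : s * (m%:R * s ^+ m * (1 - s)) <= s * (1 - s ^+ m) by exact: ler_wpM2l.
have q : 0 <= (1 - s) * (1 - s ^+ m.+1) by rewrite mulr_ge0 // subr_ge0.
move: sIH q; rewrite -natr1 !exprS; set y := s ^+ m => h1 h2; nra.
Qed.

Lemma exists_natr_expr_lt (R : realType) (r e : R) : 0 <= r < 1 -> 0 < e ->
  exists N : nat, forall m, (N <= m)%N -> m%:R * r ^+ m < e.
Proof.
move=> r01 e0; have [s /andP[s0 s1] rs] := exists_root_bound r01 (isT : (0 < 2)%N).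
have s10 : 0 < 1 - s by rewrite subr_gt0.
have s01 : 0 <= s < 1 by rewrite s0.
have [N hN] := exists_expr_lt s01 (mulr_gt0 e0 s10).
exists N => m /hN sm.
have sm0 : 0 <= s ^+ m by exact: exprn_ge0.
have sm' : m%:R * s ^+ m * (1 - s) <= 1.
  apply: le_trans (natr_expr_le m _) _; first by rewrite s0 ltW.
  by rewrite gerBl.
have rm : m%:R * r ^+ m <= (m%:R * s ^+ m) * s ^+ m.
  rewrite -mulrA ler_wpM2l // -expr2 -exprM mulnC exprM.
  by apply: lerXn2r; rewrite ?nnegrE ?exprn_ge0 //; case/andP: r01.
apply: le_lt_trans rm _; rewrite -(@ltr_pM2r _ (1 - s)); last lra.
apply: le_lt_trans sm.
rewrite mulrAC -[leRHS]mul1r; exact: ler_wpM2r.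
Qed.

Section PadicEstimates.
Context (R : realType) (p : nat) (K : fieldType) (abs : K -> R).
Hypothesis p_prime : prime p.
Hypothesis abs_na : nonarch_abs abs.
Hypothesis abs_nat : forall m : nat, (0 < m)%N -> abs m%:R = p%:R^-1 ^+ logn p m.
Local Notation P := (p%:R^-1 : R).

Lemma padic_char0 k : k.+1%:R != 0 :> K.
Proof.
apply/eqP => /(nabs_eq0 abs_na)/eqP; rewrite abs_nat // expf_eq0 invr_eq0.
by rewrite pnatr_eq0 (gtn_eqF (prime_gt0 p_prime)) andbF.
Qed.

Lemma invp_bounds : 0 < P < 1.
Proof.
have p1 : 1 < p%:R :> R by rewrite ltr1n prime_gt1.
by rewrite invr_gt0 invf_lt1 // (lt_trans ltr01 p1).
Qed.

Lemma abs_p : abs p%:R = P.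
Proof. by rewrite abs_nat ?prime_gt0 // logn_prime // eqxx. Qed.

Lemma exp_term_bound (d : K) (al : R) : 0 < al <= 1 -> al ^+ p.-1 = P -> abs d < al ->
  exists2 t : R, 0 <= t < 1 & forall k, abs (d ^+ k / k`!%:R) <= t ^+ k.
Proof.
move=> /andP[al0 al1] alP dal; exists (abs d / al).
  by rewrite divr_ge0 ?(nabs_ge0 abs_na) ?ltW //= ltr_pdivrMr // mul1r.
move=> k; rewrite (nabsM abs_na) (nabsX abs_na) (nabsV abs_na) expr_div_n.
rewrite ler_wpM2l ?exprn_ge0 ?(nabs_ge0 abs_na) //.
rewrite abs_nat ?fact_gt0 // lef_pV2 ?posrE ?exprn_gt0 ?invp_bounds //; last first.
  by case/andP: invp_bounds.
rewrite -alP -exprM; apply: ler_wiXn2l => //; first exact: ltW.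
exact: logn_fact_le.
Qed.

(* [n] stands for [n - 1] in the theorem. *)
Variables (n : nat) (w : K) (be : R).
Hypothesis be01 : 0 < be <= 1.
Hypothesis be_root : be ^+ (p ^ n * p.-1) = P.
Hypothesis w_be : abs w <= be.
Let term (k : nat) : K := w ^+ (p ^ k) / p%:R ^+ k.

Lemma term_le k : abs (term k) <= be ^+ (p ^ n) / P ^+ n.
Proof.
have [P0 P1] := andP invp_bounds; have [be0 be1] := andP be01.
have al1 : be ^+ (p ^ n) <= 1 by apply: exprn_ile1 => //; exact: ltW.
have al0 : 0 < be ^+ (p ^ n) by exact: exprn_gt0.
have alP : (be ^+ (p ^ n)) ^+ p.-1 = P by rewrite -exprM.
set al := be ^+ (p ^ n) in al1 al0 alP *.
have Pn j : 0 < P ^+ j by exact: exprn_gt0.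
rewrite /term (nabsM abs_na) (nabsV abs_na) !(nabsX abs_na) abs_p.
rewrite ler_pdivrMr // mulrAC ler_pdivlMr //.
have wk : abs w ^+ (p ^ k) <= be ^+ (p ^ k).
  by apply: lerXn2r; rewrite ?nnegrE ?(nabs_ge0 abs_na) // ltW.
have [nk|kn] := leqP n k.
  rewrite -(subnKC nk) exprD mulrA mulrAC ler_pM2r // (subnKC nk).
  apply: le_trans wk _; rewrite -{1}(subnKC nk) expnD exprM -/al -alP -exprM -exprS.
  apply: ler_wiXn2l => //; first exact: ltW.
  by have := @bernoulli_expn p (k - n) (prime_gt0 p_prime); rewrite mulnC add1n.
have wk1 : abs w ^+ (p ^ k) <= 1.
  by apply: exprn_ile1; [exact: nabs_ge0|exact: le_trans w_be be1].
have Pal : P ^+ (n - k) <= al.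
  have n0 : (0 < n - k)%N by rewrite subn_gt0.
  apply: (@le_trans _ _ P).
    by rewrite -[leRHS]expr1; apply: ler_wiXn2l => //; exact: ltW.
  rewrite -alP -[leRHS]expr1; apply: ler_wiXn2l => //; first exact: ltW.
  by have := prime_gt1 p_prime; lia.
rewrite -(subnK (ltnW kn)) exprD mulrA ler_pM2r //.
by apply: le_trans Pal; rewrite ler_piMl // ltW.
Qed.

Lemma exp_series_cvg : abs_complete abs -> abs w < 1 ->
  exists2 S : K, abs_cvg abs (fun N : nat => \sum_(k < N) term k) S &
    abs S <= be ^+ (p ^ n) / P ^+ n.
Proof.
move=> cpl w1; have p0 := prime_gt0 p_prime.
have [S hS] : exists S, abs_cvg abs (fun N : nat => \sum_(k < N) term k) S.
  apply: cpl => e e0.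
  have [N hN] := exists_natr_expr_lt (introT andP (conj (nabs_ge0 abs_na w) w1)) e0.
  have small k : (N <= k)%N -> abs (term k) < e.
    move=> Nk; have -> : abs (term k) = (p ^ k)%:R * abs w ^+ (p ^ k).
      rewrite /term (nabsM abs_na) (nabsV abs_na) !(nabsX abs_na) abs_p natrX.
      by rewrite exprVn invrK mulrC.
    apply: hN; apply: leq_trans Nk _; apply: ltnW; apply: ltn_expl.
    exact: prime_gt1.
  have near m l : (N <= l)%N -> (l <= m)%N ->
      abs (\sum_(k < m) term k - \sum_(k < l) term k) < e.
    move=> Nl lm; rewrite -!(big_mkord xpredT term).
    rewrite (big_cat_nat (leq0n l) lm) /= addrAC subrr add0r big_seq.
    apply: (nabs_sum_lt abs_na) => // k; rewrite mem_index_iota => /andP[lk _].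
    by apply: small; exact: leq_trans lk.
  exists N => m l Nm Nl; have [lm|/ltnW ml] := leqP l m; first exact: near.
  by rewrite (nabs_distC abs_na); exact: near.
exists S => //; apply: (abs_cvg_le abs_na hS); exists 0%N => N _.
apply: (nabs_sum_le abs_na) => [|k _]; last exact: term_le.
exact: le_trans (nabs_ge0 abs_na _) (term_le 0).
Qed.

End PadicEstimates.

Lemma padic_abs_nat (R : realType) (p m : nat) : (0 < m)%N ->
  padic_abs p m%:R = p%:R^-1 ^+ logn p m :> R.
Proof.
move=> m0; rewrite /padic_abs pnatr_eq0 gtn_eqF //.
have -> : (m%:R : rat) = m%:Z%:~R by [].
by rewrite numq_int denq_int logn1 /= sub0r -exprnN exprVn.
Qed.

Theorem lemma3p10 (R : realType) (p : nat) (p_prime : prime p)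
    (Qp : fieldType) (absQp : Qp -> R) (hQp : is_padic_field p absQp)
    (K : fieldExtType Qp) (abs : K -> R) (habs : extends_abs absQp abs)
    (A : set (zseries K))
    (A_alg : is_subalgebra abs A)
    (A_cap : A `&` powser = range (@sconst K))
    (A_codim : finite_codim A)
    (A_int : strictly_integral abs A)
    (b : zseries K) (hb : OA_plus_tail abs A b)
    (n : nat) (n_gt0 : (0 < n)%N)
    (c varpi : K) (c_lt1 : abs c < 1) (varpi_lt1 : abs varpi < 1)
    (hc : abs c < abs (p%:R ^+ n.-1))
    (hvarpi : abs varpi <= abs p%:R `^ ((p%:R ^+ n - p%:R ^+ n.-1)^-1)) :
  exists2 S : K,
    abs_cvg abs
      (fun N : nat => \sum_(k < N) varpi ^+ (p ^ k) / p%:R ^+ k) S &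
    exists E : zseries K,
      [/\ is_Hexp abs ((c * S) *: b) E,
          Gamma abs E &
          GammaA_class abs A E = GammaA_class abs A (sconst 1)].
Proof.
have abs_na := habs.1.
have cpl : abs_complete abs := fieldExt_complete (padic_complete hQp) habs.
have p1 := prime_gt1 p_prime; have p0 := prime_gt0 p_prime.
have abs_nat m : (0 < m)%N -> abs m%:R = p%:R^-1 ^+ logn p m.
  move=> m0; rewrite -(padic_abs_nat R p m0) -(padic_extends hQp) ratr_nat.
  by rewrite -habs.2 scaler_nat.
have absp : abs p%:R = p%:R^-1 := abs_p p_prime abs_nat.
have /andP[P0 P1] := @invp_bounds R p p_prime.
pose q := (p ^ n.-1 * p.-1)%N.
have q0 : (0 < q)%N by rewrite muln_gt0 expn_gt0 p0 /=; lia.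
have qE : p%:R ^+ n - p%:R ^+ n.-1 = q%:R :> R.
  rewrite -{1}(prednK n_gt0) exprS -{2}[p%:R ^+ _]mul1r -mulrBl.
  by rewrite /q natrM natrX mulrC -(natrB _ p0) subn1.
pose be : R := p%:R^-1 `^ q%:R^-1.
have be_root : be ^+ q = p%:R^-1.
  by rewrite -powR_mulrn ?powR_ge0 // -powRrM mulVf ?powRr1 ?ltW // pnatr_eq0 -lt0n.
have be0 : 0 < be by exact: powR_gt0.
have be1 : be <= 1.
  rewrite -(expr_le1 q0 (ltW be0)) be_root; exact: ltW.
have be01 : 0 < be <= 1 by rewrite be0.
have w_be : abs varpi <= be by rewrite /be -qE -absp.
have [S hS Sle] :=
  exp_series_cvg p_prime abs_na abs_nat be01 be_root w_be cpl varpi_lt1.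
exists S => //.
pose al := be ^+ (p ^ n.-1).
have al0 : 0 < al by exact: exprn_gt0.
have al01 : 0 < al <= 1 by rewrite al0 exprn_ile1 // ltW.
have alP : al ^+ p.-1 = p%:R^-1 by rewrite -exprM.
have cS : abs (c * S) < al.
  rewrite (nabsM abs_na); have Pn : 0 < p%:R^-1 ^+ n.-1 :> R by exact: exprn_gt0.
  rewrite (nabsX abs_na) absp in hc.
  apply: (@le_lt_trans _ _ (abs c * (al / p%:R^-1 ^+ n.-1))).
    by rewrite ler_wpM2l // (nabs_ge0 abs_na).
  by rewrite mulrCA gtr_pMr // ltr_pdivrMr // mul1r.
have [t t01 dt] := exp_term_bound p_prime abs_na abs_nat al01 alP cS.
have char0 := padic_char0 p_prime abs_na abs_nat.
exact: (exp_class_trivial abs_na cpl char0 A_alg t01 dt hb).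
Qed.
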